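(* For any Hausdorff space $X$, $$|X|\le we(X)^{\Delta_2(X)}.$$
   Context: For a family $\mathcal{U}$ of subsets of $X$ and $A\subseteq X$, put $\mathrm{St}(A,\mathcal{U})=\bigcup\{U\in\mathcal{U}:A\cap U\ne\emptyset\}$, $\mathrm{St}(x,\mathcal{U})=\mathrm{St}(\{x\},\mathcal{U})$ and $\mathrm{St}^2(x,\mathcal{U})=\mathrm{St}(\mathrm{St}(x,\mathcal{U}),\mathcal{U})$. The weak extent $we(X)$ is the least cardinal $\kappa$ such that for every open cover $\mathcal{U}$ of $X$ there is $A\subseteq X$ with $|A|\le\kappa$ and $\mathrm{St}(A,\mathcal{U})=X$. For an infinite cardinal $\kappa$, $X$ has a rank $2$ $G_\kappa$-diagonal if there is a sequence $\{\mathcal{U}_\alpha:\alpha<\kappa\}$ of open covers of $X$ such that for all $x\ne y$ in $X$ there is $\alpha<\kappa$ with $y\notin\mathrm{St}^2(x,\mathcal{U}_\alpha)$. $\Delta_2(X)$ is the least infinite cardinal $\kappa$ such that $X$ has a rank $2$ $G_\kappa$-diagonal. *)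

(* Defs.v *)
From mathcomp Require Import all_boot.
From mathcomp Require Import boolp classical_sets functions cardinality.
From mathcomp Require Import topology.

Set Implicit Arguments.
Unset Strict Implicit.
Unset Printing Implicit Defensive.

Local Open Scope classical_set_scope.
Local Open Scope card_scope.

(* A cardinal is represented by a type K of that cardinality; the order of
   cardinals is [set: K] #<= [set: L], and the cardinal power K ^ L is
   represented by the function type L -> K. *)

Definition is_least_cardinal (P : Type -> Prop) (K : Type) : Prop :=
  P K /\ forall L : Type, P L -> [set: K] #<= [set: L].

(* Unique up to equipotence; by least_cardinalP the default value Empty_set is
   not used when P respects equipotence and holds of at least one type. *)
Definition least_cardinal (P : Type -> Prop) : Type :=
  if pselect (exists K : Type, is_least_cardinal P K) is left e
  then projT1 (cid e) else Empty_set.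

Lemma card_leT_inj (K L : Type) (f : K -> L) :
  injective f -> [set: K] #<= [set: L].
Proof.
move=> finj; have fK : {in [set: K] &, injective f} by move=> x y _ _ /finj.
have := inj_card_eq fK; rewrite card_eq_le => /andP[_ le_K].
exact: card_le_trans le_K (card_leT _).
Qed.

Lemma ex_least_cardinal_family (I : Type) (T : I -> Type) :
  inhabited I -> exists i, forall j, exists f : T i -> T j, injective f.
Proof.
move=> [i0].
pose P (S : set (forall i, T i)) :=
  forall f g, S f -> S g -> f <> g -> forall i, f i <> g i.
have [F FP Ftot|S [PS maxS]] := @Zorn_bigcup _ P.
  move=> f g [A FA Af] [B FB Bg] fg.
  have [AB|BA] := Ftot _ _ FA FB.
    by apply: (FP _ FB) => //; exact: AB.
  by apply: (FP _ FA) => //; exact: BA.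
have [[i surj_i]|nsurj] := pselect (exists i, forall t : T i, exists2 f, S f & f i = t).
  exists i => j; have /choice[h hP] : forall t : T i, exists f, S f /\ f i = t.
    by move=> t; have [f Sf ft] := surj_i t; exists f.
  exists (fun t => h t j) => t t' htt'.
  have [Sh ht] := hP t; have [Sh' ht'] := hP t'.
  apply: contrapT => tt'; apply: (PS _ _ Sh Sh' _ j) => // hh.
  by apply: tt'; rewrite -ht -ht' hh.
have missed i : {t : T i | forall f, S f -> f i <> t}.
  apply: cid; apply: contrapT => nmiss; apply: nsurj; exists i => t.
  apply: contrapT => nt; apply: nmiss; exists t => f Sf ft.
  by apply: nt; exists f.
pose g i := projT1 (missed i).
have gP i f : S f -> f i <> g i by move=> Sf; exact: (projT2 (missed i)).
exfalso; apply: (maxS (S `|` [set g])).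
  split; first by move=> f Sf; left.
  move=> sub; have Sg : S g by apply: sub; right.
  exact: (gP i0 g Sg).
move=> f f' [Sf|->] [Sf'|->] ff' i //.
- exact: PS.
- exact: gP.
- by move=> /esym; exact: gP.
Qed.

Lemma inj_total (K L : Type) :
  (exists f : K -> L, injective f) \/ (exists f : L -> K, injective f).
Proof.
have [[] leb] := @ex_least_cardinal_family bool (fun b => if b then K else L)
  (inhabits true).
  by left; exact: (leb false).
by right; exact: (leb true).
Qed.

Lemma card_setT_sig (K : Type) (A : set K) : [set: {x : K | A x}] #= A.
Proof.
have inj1 : {in [set: {x : K | A x}] &, injective (@proj1_sig K A)}.
  by move=> [x Ax] [y Ay] _ _ /= xy; exact: eq_exist.
have imE : @proj1_sig K A @` [set: _] = A.
  by apply/seteqP; split=> [_ [[x Ax] _ <-]//|x Ax]; exists (exist _ x Ax).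
by have := inj_card_eq inj1; rewrite imE card_eq_sym.
Qed.

Lemma least_cardinalP (P : Type -> Prop) :
  (forall K L : Type, [set: K] #= [set: L] -> P K -> P L) ->
  (exists K, P K) -> is_least_cardinal P (least_cardinal P).
Proof.
move=> Peq [K0 PK0].
pose I := {A : set K0 | P {x | A x}}.
have subP (A : set K0) K : P K -> [set: K] #= A -> P {x | A x}.
  move=> PK KA; apply: Peq PK; apply: card_eq_trans KA _.
  by rewrite card_eq_sym card_setT_sig.
have exP : exists K, is_least_cardinal P K.
  have [[A PA] leA] :=
    @ex_least_cardinal_family I (fun i => {x | proj1_sig i x})
      (inhabits (exist _ [set: K0] (subP [set: K0] _ PK0 (card_eqxx _)))).
  exists {x | A x}; split=> // L PL.
  have [[f finj]|[f finj]] := inj_total K0 L.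
    apply: card_le_trans (card_leT_inj finj).
    by rewrite (card_le_eql (card_setT_sig A)); exact: card_leT.
  have LB : [set: L] #= f @` [set: L].
    by rewrite card_eq_sym; apply: inj_card_eq => x y _ _ /finj.
  have [g ginj] := leA (exist _ (f @` [set: L]) (subP _ _ PL LB)).
  apply: card_le_trans (card_leT_inj ginj) _ => /=.
  by rewrite (card_le_eql (card_setT_sig _)) (card_le_eqr LB).
by rewrite /least_cardinal; case: pselect => // e; exact: (projT2 (cid e)).
Qed.

Definition open_cover (X : topologicalType) (U : set (set X)) : Prop :=
  (forall V, U V -> open V) /\ \bigcup_(V in U) V = [set: X].

Definition St (X : Type) (A : set X) (U : set (set X)) : set X :=
  \bigcup_(V in [set V | U V /\ A `&` V !=set0]) V.

Definition St2 (X : Type) (x : X) (U : set (set X)) : set X :=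
  St (St [set x] U) U.

Definition weak_extent_le (X : topologicalType) (K : Type) : Prop :=
  forall U : set (set X), open_cover U ->
    exists A : set X, A #<= [set: K] /\ St A U = [set: X].

Definition we (X : topologicalType) : Type := least_cardinal (weak_extent_le X).

Definition rank2_diagonal (X : topologicalType) (K : Type) : Prop :=
  exists U : K -> set (set X),
    (forall a, open_cover (U a)) /\
    forall x y, x <> y -> exists a, ~ St2 x (U a) y.

Definition Delta2 (X : topologicalType) : Type :=
  least_cardinal (fun K => infinite_set [set: K] /\ rank2_diagonal X K).

(* The minima defining we X and Delta2 X exist: the former always, the latter
   for Hausdorff spaces. *)

Lemma weP (X : topologicalType) : is_least_cardinal (weak_extent_le X) (we X).
Proof.
apply: least_cardinalP.
  move=> K L; rewrite card_eq_le => /andP[KL _] PK U /PK[A [AK StA]].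
  by exists A; split=> //; exact: card_le_trans KL.
exists X => U [_ covU]; exists [set: X]; split=> //.
apply/seteqP; split=> // x _.
have [V UV Vx] : (\bigcup_(V in U) V) x by rewrite covU.
by exists V => //; split=> //; exists x.
Qed.

Lemma Delta2P (X : topologicalType) : hausdorff_space X ->
  is_least_cardinal
    (fun K => infinite_set [set: K] /\ rank2_diagonal X K) (Delta2 X).
Proof.
move=> hX; apply: least_cardinalP.
  move=> K L KL [infK [U [covU sepU]]]; split.
    by move: KL; rewrite card_eq_le => /andP[le_KL _] /(card_le_finite le_KL).
  move: KL; rewrite card_eq_sym => /card_bijP[g [h _ hK]].
  pose inT (T : Type) (t : T) : [set: T] := SigSub (mem_set (I : [set: T] t)).
  exists (fun l => U (val (g (inT L l)))); split=> [a|x y /sepU[k Uk]].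
    exact: covU.
  exists (val (h (inT K k))); suff -> : inT L (val (h (inT K k))) = h (inT K k).
    by rewrite hK.
  exact: val_inj.
exists ((X * X) + nat)%type; split.
  move=> fin; apply: infinite_nat; apply: card_le_finite fin.
  by apply: (@card_leT_inj _ _ inr) => ? ? [].
have sep x y : exists U : set (set X),
    open_cover U /\ (x <> y -> ~ St2 x U y).
  have [->|/eqP xy] := pselect (x = y).
    exists [set setT]; split=> //; split; first by move=> _ ->; exact: openT.
    by rewrite bigcup_set1.
  have := hX; rewrite open_hausdorff.
  move=> /(_ x y xy)[[A B] /= [xA yB] [oA oB AB0]].
  pose C := ~` [set x; y].
  have oC : open C.
    rewrite openC; have acc := hausdorff_accessible hX.
    by apply: closedU; exact: accessible_closed_set1.
  have {}xA : A x by rewrite -in_setE.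
  have {}yB : B y by rewrite -in_setE.
  have AB z : A z -> B z -> False.
    by move=> Az Bz; have : (A `&` B) z by []; rewrite (eqP AB0).
  exists [set A; B; C]; split.
    split; first by move=> _ [[->|->]|->].
    apply/seteqP; split=> // z _.
    have [->|zx] := pselect (z = x); first by exists A => //; left; left.
    have [->|zy] := pselect (z = y); first by exists B => //; left; right.
    by exists C; [right|case].
  move=> _ [V [UV [z [[W [UW [w [-> Wx]]] Wz] Vz]]] Vy].
  have {UW Wx}WA : W = A.
    case: UW Wx => [[->//|-> /(AB _ xA)//]|->]; first by case; left.
  have {UV Vy}VB : V = B.
    case: UV Vy => [[-> Ay|->//]|->]; first by case: (AB _ Ay yB).
    by case; right.
  by move: Wz Vz; rewrite WA VB; exact: AB.
have /choice[F FP] : forall p : X * X, exists U : set (set X),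
  open_cover U /\ (p.1 <> p.2 -> ~ St2 p.1 U p.2) by move=> p; exact: sep.
exists (fun a => match a with inl p => F p | inr _ => [set setT] end); split.
  move=> [p|_]; first by have [] := FP p.
  by split; [move=> _ ->; exact: openT|rewrite bigcup_set1].
by move=> x y xy; exists (inl (x, y)); exact: (FP (x, y)).2.
Qed.

(* Main.v *)
(* For each of the covers U_k witnessing the rank 2 diagonal, label x by a point
   of a star-dense set whose U_k-star contains x: points sharing a label lie in
   each other's double stars, so the family of labels determines x. *)

Require Import Defs.
From mathcomp Require Import all_boot.
From mathcomp Require Import boolp classical_sets functions cardinality.
From mathcomp Require Import topology.

Local Open Scope classical_set_scope.
Local Open Scope card_scope.

(** The star-dense set varies with [U]; injecting it into [K] gives all covers one label type. *)
Lemma weak_extent_le_index (X : topologicalType) (K : Type)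
    (U : set (set X)) :
  weak_extent_le X K -> open_cover U ->
  exists f : X -> K, forall x y, f x = f y -> St2 x U y.
Proof.
move=> weK /weK[A [/card_leP[g] StA]].
have /choice[a aP] x : exists a : A, exists V, [/\ U V, V (val a) & V x].
  have [V [UV [a [Aa Va]]] Vx] : St A U x by rewrite StA.
  by exists (SigSub (mem_set Aa)), V.
exists (fun x => val (g (a x))) => x y /val_inj gxy.
have axy : a x = a y by apply: (@inj _ _ _ g); rewrite ?inE.
have [V [UV Va Vx]] := aP x; have [W [UW Wa Wy]] := aP y.
(* [W] contains [y] and meets the star of [x] at the common point [a x], which [V] joins to [x]. *)
exists W => //; split=> //; exists (val (a x)); split; last by rewrite axy.
by exists V => //; split=> //; exists x.
Qed.

Theorem proposition4p3 (X : topologicalType) (hX : hausdorff_space X) :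
  [set: X] #<= [set: Delta2 X -> we X].
Proof.
(* Hausdorffness makes [Delta2 X] an attained minimum, not the default [Empty_set], so it indexes
   separating covers. *)
have [[_ [U [covU sepU]]] _] := Delta2P hX.
have /choice[f fP] k := weak_extent_le_index _ _ _ (proj1 (weP X)) (covU k).
apply: (@card_leT_inj _ _ (fun x k => f k x)) => x y fxy.
apply: contrapT => /sepU[k]; apply; apply: (fP k).
exact: (congr1 (@^~ k) fxy).
Qed.
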